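(* Let $n\ge 1$. Let $\mathcal{H}_n$ be the set of all halved alternating sign matrices $A$ of order $2n$ (these are $n\times 2n$ matrices) whose height matrix $h=(h_{ij})_{0\le i\le n,\,0\le j\le 2n}$ satisfies the boundary condition $h_{n,2i}=n$ for all $0\le i\le n$. For $A\in\mathcal{H}_n$ let $N_{-}(A)$ be the number of entries of $A$ equal to $-1$. Then $$\sum_{A\in\mathcal{H}_n}2^{N_{-}(A)}=2^{n^2}.$$
   Context: A halved alternating sign matrix of order $2n$ is an $n\times 2n$ matrix $A=(a_{ij})_{1\le i\le n,\,1\le j\le 2n}$ with entries in $\{0,1,-1\}$ such that: in each row and in each column the non-zero entries alternate in sign; each row sum equals $1$; and in each column the first (topmost) non-zero entry, if there is any, equals $1$. The height matrix of $A$ is the $(n+1)\times(2n+1)$ matrix $h$ with $h_{ij}=i+j-2\sum_{l=1}^{i}\sum_{r=1}^{j}a_{lr}$ for $0\le i\le n$, $0\le j\le 2n$ (empty sums are $0$). Its top row is automatically $(0,1,\dots,2n)$, its left column is $(0,1,\dots,n)$, its right column is $(2n,2n-1,\dots,n)$ (top to bottom), and adjacent entries differ by one. The boundary condition in the claim says that the bottom row of $h$ has the form $(n,c_1,n,c_2,n,\dots,n,c_n,n)$, where $c_i=h_{n,2i-1}$ for $1\le i\le n$ is otherwise unrestricted (so each $c_i$ is $n-1$ or $n+1$). *)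

(* Defs.v *)
From mathcomp Require Import all_boot all_order all_algebra.

Set Implicit Arguments.
Unset Strict Implicit.
Unset Printing Implicit Defensive.

Import Order.TTheory GRing.Theory Num.Theory.
Local Open Scope ring_scope.

(* As a finType, this makes the type of all matrices over it finite;
   [ssval] is the inclusion into [int]. *)
Definition asm_entry : finType := seq_sub ([:: 0; 1; -1] : seq int).

Definition int_mx (m p : nat) (A : 'M[asm_entry]_(m, p)) : 'M[int]_(m, p) :=
  map_mx (fun x : asm_entry => ssval x) A.

Definition nonzeros (s : seq int) : seq int := [seq x <- s | x != 0].

Definition alternating (s : seq int) : bool :=
  sorted (fun x y : int => x * y < 0) (nonzeros s).

Definition row_seq (m p : nat) (A : 'M[int]_(m, p)) (i : 'I_m) : seq int :=
  [seq A i j | j <- enum 'I_p].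

Definition col_seq (m p : nat) (A : 'M[int]_(m, p)) (j : 'I_p) : seq int :=
  [seq A i j | i <- enum 'I_m].

(* In the last condition the default value 1 of [head] accounts for columns
   without non-zero entries. *)
Definition halved_asm (n : nat) (A : 'M[int]_(n, 2 * n)) : bool :=
  [&& [forall i, alternating (row_seq A i)],
      [forall j, alternating (col_seq A j)],
      [forall i, \sum_j A i j == 1]
    & [forall j, head 1 (nonzeros (col_seq A j)) == 1]].

(* Rows and columns of [A] are numbered from 0 here, so the ranges 1 <= l <= i
   and 1 <= r <= j of the usual 1-based formula become l < i and r < j. *)
Definition height_mx (n : nat) (A : 'M[int]_(n, 2 * n)) :
    'M[int]_(n.+1, (2 * n).+1) :=
  \matrix_(i < n.+1, j < (2 * n).+1)
    (i%:Z + j%:Z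
     - 2 * \sum_(l < n | (l < i)%N) \sum_(r < 2 * n | (r < j)%N) A l r).

(* For i <= n the index 2 * i is within bounds, so [inord] does not truncate. *)
Definition height_boundary (n : nat) (A : 'M[int]_(n, 2 * n)) : bool :=
  [forall i : 'I_n.+1, height_mx A ord_max (inord (2 * i)) == n%:Z].

Definition bounded_halved_asms (n : nat) : {set 'M[asm_entry]_(n, 2 * n)} :=
  [set A | halved_asm (int_mx A) && height_boundary (int_mx A)].

Definition num_minus_ones (m p : nat) (A : 'M[int]_(m, p)) : nat :=
  #|[set ij : 'I_m * 'I_p | A ij.1 ij.2 == -1]|.

(* Main.v *)
Require Import Defs.
From mathcomp Require Import all_boot all_order all_algebra.
From mathcomp Require Import zify ring.
Import Order.TTheory GRing.Theory Num.Theory.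

(** Adding up the rows one at a time, a halved alternating sign matrix becomes a
    monotone triangle: the column sums of the first m rows are the indicator of
    m positions k_0 < ... < k_(m-1), and consecutive rows interlace. Let p_j(x)
    be the coefficient of t^j in ((1 + t) / (1 - t))^x, so that
    p_(j+1)(x+1) - p_(j+1)(x) = p_j(x) + p_j(x+1). The 2-enumeration of the
    triangles with bottom row k is det (p_j(k_i)), by induction on m: the weight
    of an interlacing row is a product over its entries, so by multilinearity
    the sum over that row telescopes entrywise to
    det (p_(j+1)(k_(i+1)) - p_(j+1)(k_i)), and the rows that are not strictly
    increasing contribute vanishing determinants. The boundary condition says
    k_i = 2i or 2i + 1 (counting from 0), so the total is det (r_j(i)) with
    r_j(i) = p_j(2i) + p_j(2i+1). The generating functions G_i of r_j(i) satisfy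
    G_(i+1) = (1 + 4t / (1-t)^2) G_i, hence subtracting consecutive rows gives
    D_(n+1) = 2 * 4^n * D_n. *)

Section TwoEnumeration.
Set Implicit Arguments.
Unset Strict Implicit.
Local Open Scope ring_scope.

(** * Determinants: row differences and multilinearity *)

Lemma det_const_col0 (R : comNzRingType) (n : nat) (M : 'M[R]_n.+1) (c : R) :
    (forall i, M i ord0 = c) ->
  \det M = c * \det (\matrix_(i < n, j < n)
    (M (lift ord0 i) (lift ord0 j) - M (widen_ord (leqnSn n) i) (lift ord0 j))).
Proof.
(* Left multiplication by the unitriangular [D] subtracts from each row the row above it, which
   leaves (c, 0, ..., 0) as first column. *)
move=> Mc; pose D : 'M[R]_n.+1 := 1 - \matrix_(i, j) (i == j.+1 :> nat)%:R.
have detD : \det D = 1.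
  rewrite det_trig; last first.
    by apply/is_trig_mxP => *; rewrite !mxE ![_ == _]ltn_eqF ?subr0 ?leqW.
  by rewrite big1 // => i _; rewrite !mxE eqxx ltn_eqF // subr0.
have DM i j : (D *m M) i j = M i j - \sum_(k < n.+1 | i == k.+1 :> nat) M k j.
  rewrite mulmxBl mul1mx !mxE; congr (_ - _); rewrite [RHS]big_mkcond.
  by apply: eq_bigr => k _; rewrite mxE mulr_natl mulrb.
rewrite -[LHS]mul1r -detD -det_mulmx (expand_det_col _ ord0) big_ord_recl.
rewrite big1 => [|i _].
  rewrite addr0 DM big_pred0 // subr0 Mc /cofactor expr0 mul1r; congr (_ * \det _).
  apply/matrixP => i j; rewrite [RHS]mxE 2!mxE DM; congr (_ - _).
  by rewrite (big_pred1 (widen_ord (leqnSn n) i)).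
by rewrite DM (big_pred1 (widen_ord (leqnSn n) i)) // !Mc subrr mul0r.
Qed.

(** Multilinearity in the rows: for each permutation in the Leibniz formula, the product of sums
    expands over all choice functions [f]. *)
Lemma sum_prod_det (R : comNzRingType) (J : finType) (n : nat)
    (w : 'I_n -> J -> R) (v : J -> 'I_n -> R) :
  \sum_(f : {ffun 'I_n -> J})
      (\prod_i w i (f i)) * \det (\matrix_(i, j) v (f i) j)
    = \det (\matrix_(i, j) \sum_x w i x * v x j).
Proof.
rewrite /determinant; under eq_bigr do rewrite big_distrr.
rewrite exchange_big; apply: eq_bigr => s _.
under [in RHS]eq_bigr do rewrite mxE.
rewrite bigA_distr_bigA big_distrr; apply: eq_bigr => f _ /=.
rewrite mulrCA -big_split; congr (_ * _); apply: eq_bigr => i _.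
by rewrite mxE.
Qed.

(** * Coefficients of powers of (1 + t) / (1 - t) and their telescoping sums *)

(* [cdel j x] is the coefficient of t^j in ((1 + t) / (1 - t))^x. *)
Fixpoint cdel (j x : nat) : int :=
  if j is i.+1 then \sum_(y < x) (cdel i y + cdel i y.+1) else 1.

Lemma cdelS j x : cdel j.+1 x.+1 = cdel j.+1 x + (cdel j x + cdel j x.+1).
Proof. by rewrite /= big_ord_recr. Qed.

Lemma cdel0 j : cdel j.+1 0 = 0.
Proof. by rewrite /= big_ord0. Qed.

Arguments cdel : simpl never.

Lemma sum_cdelS j b :
  \sum_(x < b) cdel j x + \sum_(x < b.+1) cdel j x = cdel j.+1 b + cdel j 0.
Proof.
elim: b => [|b IHb]; first by rewrite big_ord0 big_ord1 cdel0.
by rewrite big_ord_recr [X in _ + X]big_ord_recr /= addrACA IHb cdelS; ring.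
Qed.

Lemma sum_bool_ltn (N b : nat) (F : nat -> int) :
  (b <= N)%N -> \sum_(x < N) (x < b)%:R * F x = \sum_(x < b) F x.
Proof.
move=> leb; rewrite (big_ord_widen N) // [RHS]big_mkcond.
by apply: eq_bigr => x _; rewrite mulr_natl mulrb.
Qed.

(* Equals 2 in the interior of [a, b], 1 at its ends and 0 outside: when the new
   row of a monotone triangle has consecutive entries a < b, an entry x of the
   previous row between them contributes a -1 iff it is interior. *)
Definition edge_weight (a b x : nat) : int :=
  (a <= x < b)%:R + (a < x <= b)%:R.

Lemma sum_edge_weight (N a b j : nat) : (a < b < N)%N ->
  \sum_(x < N) edge_weight a b x * cdel j x = cdel j.+1 b - cdel j.+1 a.
Proof.
case/andP=> ltab ltbN.
(* The two indicators in [edge_weight a b x] are [x < b] - [x < a] and [x < b+1] - [x < a+1], hence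
   four cumulative sums. The bound b < N keeps b + 1 in range. *)
pose L c := \sum_(x < N) (x < c)%:R * cdel j x.
have -> : cdel j.+1 b - cdel j.+1 a = L b + L b.+1 - (L a + L a.+1).
  rewrite /L !sum_bool_ltn ?sum_cdelS //; [ring | lia..].
rewrite /L -!big_split -sumrB; apply: eq_bigr => x _ /=.
rewrite -!mulrDl -mulrBl; congr (_ * _); rewrite /edge_weight; lia.
Qed.

(** On the right, column 0 is constantly 1, so row differences remove it; [sum_edge_weight]
    identifies the remaining entries. *)
Lemma det_cdelS (m N : nat) (f : 'I_m.+1 -> nat) :
    (forall i : 'I_m, f (widen_ord (leqnSn m) i) < f (lift ord0 i) < N)%N ->
  \det (\matrix_(i < m, j < m) \sum_(x < N)
      edge_weight (f (widen_ord (leqnSn m) i)) (f (lift ord0 i)) x * cdel j x)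
  = \det (\matrix_(i < m.+1, j < m.+1) cdel j (f i)).
Proof.
move=> fS; rewrite (det_const_col0 (c := 1)) => [|i]; last by rewrite mxE.
rewrite mul1r; congr (\det _); apply/matrixP => i j; rewrite !mxE.
by rewrite sum_edge_weight.
Qed.

(** * Evaluation of the final determinant *)

Definition cdel2 (i j : nat) : int := cdel j i.*2 + cdel j i.*2.+1.

(** Coefficient extraction in G_(i+1) = (1 + 4t / (1-t)^2) G_i, since t^m has coefficient 4m in 4t /
    (1-t)^2. *)
Lemma cdel2_diff i j : cdel2 i.+1 j.+1 - cdel2 i j.+1
  = 4 * \sum_(l < j.+1) (j.+1 - l)%N%:R * cdel2 i l.
Proof.
suff H k : cdel2 i.+1 k = cdel2 i k + 4 * \sum_(l < k) (k - l)%N%:R * cdel2 i l.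
  by rewrite H; ring.
have E0 : cdel2 i.+1 0 = cdel2 i 0 by [].
have E1 : cdel2 i.+1 1 = cdel2 i 1 + 4 * cdel2 i 0.
  by rewrite /cdel2 doubleS !cdelS /=; ring.
(* The coefficient of t^(l+2) in (1-t)^2 G_(i+1) = ((1-t)^2 + 4t) G_i. *)
have E2 l : cdel2 i.+1 l.+2 =
    2 * cdel2 i.+1 l.+1 - cdel2 i.+1 l + cdel2 i l.+2 - 2 * cdel2 i l.+1
    + cdel2 i l + 4 * cdel2 i l.+1.
  by rewrite /cdel2 doubleS !cdelS; ring.
elim/ltn_ind: k => [[|[|k]]] IH.
- by rewrite big_ord0 E0 mulr0 addr0.
- by rewrite big_ord1 E1 subn0 mul1r.
rewrite E2 !IH //.
have S2 : \sum_(l < k.+2) (k.+2 - l)%N%:R * cdel2 i l =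
   2 * \sum_(l < k.+1) (k.+1 - l)%N%:R * cdel2 i l -
     \sum_(l < k) (k - l)%N%:R * cdel2 i l + cdel2 i k.+1.
  rewrite !big_ord_recr /=.
  rewrite !subSnn (_ : k.+2 - k = 2)%N; last lia.
  suff -> : \sum_(l < k) (k.+2 - l)%N%:R * cdel2 i l =
     2 * (\sum_(l < k) (k.+1 - l)%N%:R * cdel2 i l) -
     \sum_(l < k) (k - l)%N%:R * cdel2 i l by ring.
  rewrite mulr_sumr -sumrB; apply: eq_bigr => l _.
  by rewrite !subSn ?(leqW (ltnW _)) // ?[(l <= k)%N]ltnW //; ring.
rewrite S2; ring.
Qed.

Lemma det_cdel2 n :
  \det (\matrix_(i < n, j < n) cdel2 i j) = 2 ^+ (n ^ 2).
Proof.
elim: n => [|n IHn]; first by rewrite det_mx00.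
rewrite (det_const_col0 (c := 2)) => [|i]; last by rewrite mxE.
(* [C] encodes multiplication by 4t / (1-t)^2. Its columns are shifted by one because column 0 has
   been dropped, so its diagonal entries are 4. *)
pose C : 'M[int]_n := \matrix_(l, j) (if (l <= j)%N then 4 * (j.+1 - l)%N%:R else 0).
have detC : \det C = 4 ^+ n.
  rewrite -det_tr det_trig => [|]; last first.
    by apply/is_trig_mxP => i j ij; rewrite !mxE leqNgt ij.
  rewrite (eq_bigr (fun=> 4)) ?prodr_const ?card_ord // => i _.
  by rewrite !mxE leqnn subSnn mulr1.
set M := (X in \det X).
have {M}-> : M = (\matrix_(i < n, j < n) cdel2 i j) *m C.
  apply/matrixP => i j; rewrite !mxE /= cdel2_diff big_distrr /=.
  rewrite (big_ord_widen n (fun l => 4 * ((j.+1 - l)%N%:R * cdel2 i l))) //.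
  rewrite big_mkcond; apply: eq_bigr => l _; rewrite !mxE ltnS.
  by case: ifP => _; ring.
rewrite det_mulmx detC IHn.
rewrite (_ : 4 = 2 ^+ 2) // -exprM -exprD -exprS; congr (_ ^+ _); lia.
Qed.

(** * Sign alternation as a condition on partial sums *)

Definition in01 (c : int) : bool := (c == 0) || (c == 1).

Definition prefix01 (s : seq int) : bool := all in01 (scanl +%R 0 s).

(** Here [b] is the partial sum already reached: the next non-zero entry must be 1 after 0 and -1
    after 1, that is (-1)^b. The default of [head] covers sequences without non-zero entries. *)
Lemma alternating_scanl (b : bool) (s : seq int) :
    all [in [:: 0; 1; -1]] s ->
  alternating s && (head ((-1) ^+ b) (nonzeros s) == (-1) ^+ b)
    = all in01 (scanl +%R b%:R s).
Proof.
elim: s b => [|x s IHs] b /=; first by rewrite /alternating /= eqxx.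
case/andP=> x01 s01.
have step (c : bool) : alternating ((-1) ^+ c :: s)
    = alternating s && (head ((-1) ^+ (~~ c)) (nonzeros s) == (-1) ^+ (~~ c)).
  rewrite /alternating /nonzeros /= signr_eq0 /=.
  have: all [in [:: 1; -1 : int]] [seq x <- s | x != 0].
    apply/allP=> y; rewrite mem_filter => /andP[/negPf y0 /(allP s01)].
    by rewrite /= inE y0.
  case: [seq x <- s | x != 0] => [|z t] /=; first by rewrite eqxx.
  by rewrite !inE => /andP[/orP[]/eqP-> _]; case: c => /=; rewrite ?andbT ?andbF.
move: x01; rewrite !inE => /or3P[]/eqP->; rewrite ?addr0.
- by rewrite /alternating /nonzeros /= -IHs //; case: b.
- rewrite (step false); case: b => /=; first by rewrite andbF.
  by rewrite andbT add0r (IHs true).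
- rewrite (step true); case: b => /=; last by rewrite andbF.
  by rewrite andbT subrr (IHs false).
Qed.

Lemma alternating_prefix01 (s : seq int) : all [in [:: 0; 1; -1]] s ->
  alternating s && (head 1 (nonzeros s) == 1) = prefix01 s.
Proof. exact: (alternating_scanl false). Qed.

Lemma in01_sum (c : int) (s : seq int) :
  in01 c -> all in01 (scanl +%R c s) -> in01 (c + \sum_(x <- s) x).
Proof.
elim: s c => [|x s IHs] c c01 /=; first by rewrite big_nil addr0.
by case/andP=> cx /IHs; rewrite big_cons addrA; apply.
Qed.

(** An alternating sequence starting with -1 has partial sums in {0, 1} when counted from 1, so its
    total is at most 0; total 1 thus forces the first non-zero entry to be 1. *)
Lemma alternating_sum1 (s : seq int) :
    all [in [:: 0; 1; -1]] s ->
  alternating s && (\sum_(x <- s) x == 1)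
    = prefix01 s && (\sum_(x <- s) x == 1).
Proof.
move=> s01; rewrite -alternating_prefix01 //.
have [sum1|] := eqVneq (\sum_(x <- s) x) 1; last by rewrite !andbF.
rewrite !andbT; case alts: (alternating s) => //=.
have [//|ne1] := eqVneq.
have := alternating_scanl true s01; rewrite alts /=.
have -> : head (-1) (nonzeros s) == -1.
  have: all [in [:: 1; -1 : int]] (nonzeros s).
    apply/allP=> y; rewrite mem_filter => /andP[/negPf y0 /(allP s01)].
    by rewrite /= inE y0.
  case: (nonzeros s) ne1 => //= z t; rewrite !inE.
  by move=> /negPf-> /andP[].
by move=> /esym alls; have := in01_sum (isT : in01 1) alls; rewrite sum1.
Qed.

(** * Halved matrices of any shape, and appending a row *)

(** The number of rows is independent of the number of columns, to allow induction on the rows. *)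
Definition half_asm (m N : nat) (A : 'M[int]_(m, N)) : bool :=
  [forall i, prefix01 (row_seq A i) && (\sum_j A i j == 1)]
  && [forall j, prefix01 (col_seq A j)].

Lemma half_asmE n (A : 'M[asm_entry]_(n, 2 * n)) :
  halved_asm (int_mx A) = half_asm (int_mx A).
Proof.
have A01 i j : int_mx A i j \in [:: 0; 1; -1] by rewrite mxE ssvalP.
have row01 i : all [in [:: 0; 1; -1]] (row_seq (int_mx A) i).
  by apply/allP=> _ /mapP[j _ ->].
have col01 j : all [in [:: 0; 1; -1]] (col_seq (int_mx A) j).
  by apply/allP=> _ /mapP[i _ ->].
have rowE i : alternating (row_seq (int_mx A) i) && (\sum_j int_mx A i j == 1)
   = prefix01 (row_seq (int_mx A) i) && (\sum_j int_mx A i j == 1).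
  have := alternating_sum1 (row01 i).
  by rewrite big_map big_enum.
apply/and4P/andP => [[/forallP r1 /forallP c1 /forallP r2 /forallP c2]|].
  split; apply/forallP => i; first by rewrite -rowE r1 r2.
  by rewrite -alternating_prefix01 // c1 c2.
case=> /forallP r /forallP c.
have c' j: alternating (col_seq (int_mx A) j) &&
   (head 1 (nonzeros (col_seq (int_mx A) j)) == 1).
  by rewrite (alternating_prefix01 (col01 j)) c.
have r' i : alternating (row_seq (int_mx A) i) && (\sum_j int_mx A i j == 1).
  by rewrite rowE r.
split; apply/forallP=> i; first [by case/andP: (r' i) | by case/andP: (c' i)].
Qed.

Lemma half_asm_col_mx m N (A : 'M[int]_(m, N)) (a : 'rV_N) :
  half_asm (col_mx A a) =
  [&& half_asm A, prefix01 (row_seq a 0), \sum_j a 0 j == 1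
    & [forall j, in01 (\sum_l A l j + a 0 j)]].
Proof.
have rowl i : row_seq (col_mx A a) (lshift 1 i) = row_seq A i.
  by apply: eq_map => j; rewrite col_mxEu.
have rowr : row_seq (col_mx A a) (rshift m 0) = row_seq a 0.
  by apply: eq_map => j; rewrite col_mxEd.
have suml i : \sum_j col_mx A a (lshift 1 i) j = \sum_j A i j.
  by apply: eq_bigr => j; rewrite col_mxEu.
have sumr : \sum_j col_mx A a (rshift m 0) j = \sum_j a 0 j.
  by apply: eq_bigr => j; rewrite col_mxEd.
have colE j : col_seq (col_mx A a) j = rcons (col_seq A j) (a 0 j).
  have enumD : enum 'I_(m + 1) = rcons (map (lshift 1) (enum 'I_m)) (rshift m 0).
    apply: (inj_map val_inj); apply: etrans (val_enum_ord _) _.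
    rewrite map_rcons -map_comp -cats1 iotaD -[iota 0 m]val_enum_ord /=.
    by rewrite addn0.
  rewrite /col_seq enumD map_rcons -map_comp col_mxEd; congr rcons.
  by apply: eq_map => i /=; rewrite col_mxEu.
have preE j : prefix01 (col_seq (col_mx A a) j) =
    prefix01 (col_seq A j) && in01 (\sum_l A l j + a 0 j).
  rewrite colE /prefix01 scanl_rcons all_rcons andbC -cats1 foldl_cat /=.
  congr (_ && in01 (_ + _)).
  by rewrite foldl_idx big_map big_enum.
apply/andP/and4P=> [[/forallP r /forallP c]|].
- split.
  + apply/andP; split; apply/forallP=> i; first by rewrite -rowl -suml.
    by have := c i; rewrite preE => /andP[].
  + by case/andP: (r (rshift m 0)); rewrite rowr.
  + by case/andP: (r (rshift m 0)); rewrite sumr.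
  + by apply/forallP=> j; have := c j; rewrite preE => /andP[].
- case=> /andP[/forallP r /forallP c] ra sa /forallP ca.
  split; apply/forallP=> i; last by rewrite preE c ca.
  case: (split_ordP i) => k ->; first by rewrite rowl suml.
  by rewrite [k]ord1 rowr sumr ra.
Qed.

Lemma num_minus_onesE m N (A : 'M[int]_(m, N)) :
  num_minus_ones A = (\sum_i \sum_j (A i j == -1)%R)%N.
Proof.
rewrite /num_minus_ones -sum1_card big_mkcond pair_bigA; apply: eq_bigr => ij _.
by rewrite inE; case: eqP.
Qed.

Lemma num_minus_ones_col_mx m1 m2 N (A : 'M[int]_(m1, N)) (B : 'M_(m2, N)) :
  num_minus_ones (col_mx A B) = (num_minus_ones A + num_minus_ones B)%N.
Proof.
rewrite !num_minus_onesE big_split_ord; congr (_ + _)%N; apply: eq_bigr => i _;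
  by apply: eq_bigr => j _; rewrite ?col_mxEu ?col_mxEd.
Qed.

(** * Increasing position vectors and their counting functions *)

Definition strict (m N : nat) (f : 'I_m -> 'I_N) : bool :=
  [forall i : 'I_m, forall j : 'I_m, (i < j)%N ==> (f i < f j)%N].

Lemma strictP m N (f : 'I_m -> 'I_N) :
  reflect (forall i j : 'I_m, (i < j)%N -> (f i < f j)%N) (strict f).
Proof.
apply: (iffP forallP) => sf i; first by move=> j; apply/implyP/(forallP (sf i)).
by apply/forallP => j; apply/implyP/sf.
Qed.

Lemma strict_leq m N (f : 'I_m -> 'I_N) (i j : 'I_m) :
  strict f -> (i <= j)%N -> (f i <= f j)%N.
Proof.
move=> /strictP sf; rewrite leq_eqVlt => /orP[/eqP/val_inj-> // | /sf].
exact: ltnW.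
Qed.

Lemma strict_inj m N (f : 'I_m -> 'I_N) : strict f -> injective f.
Proof.
move=> /strictP sf i j /(congr1 val) /= fij; apply/val_inj/eqP.
by case: ltngtP => // /sf; rewrite fij ltnn.
Qed.

Definition cnt (m N : nat) (f : 'I_m -> 'I_N) (k : nat) : nat :=
  (\sum_i (f i < k))%N.

Lemma cntE m N (f : 'I_m -> 'I_N) k : cnt f k = #|[pred i | (f i < k)%N]|.
Proof.
rewrite /cnt -sum1_card [RHS]big_mkcond; apply: eq_bigr => i _.
by rewrite inE; case: ifP.
Qed.

Lemma cnt_le m N (f : 'I_m -> 'I_N) k : (cnt f k <= m)%N.
Proof. by rewrite cntE -[X in (_ <= X)%N]card_ord max_card. Qed.

(** The indices with value below [k] form an initial segment of ['I_m], of length [cnt f k]. *)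
Lemma ltn_cnt m N (f : 'I_m -> 'I_N) (i : 'I_m) k :
  strict f -> (i < cnt f k)%N = (f i < k)%N.
Proof.
move=> sf.
have cardlt (l : nat) : (l <= m)%N -> #|[pred j : 'I_m | (j < l)%N]| = l.
  move=> lelm; rewrite -sum1_card -[RHS]muln1 -[in RHS](card_ord l) -sum_nat_const.
  by rewrite (big_ord_widen m (fun=> 1%N)).
rewrite cntE; apply/idP/idP => [|fik].
  apply: contraLR; rewrite -!leqNgt => lekf.
  rewrite -[X in (_ <= X)%N](cardlt i) ?(ltnW (ltn_ord i)) //.
  apply/subset_leq_card/subsetP => j; rewrite !inE => fjk.
  rewrite ltnNge; apply/negP => /(strict_leq sf) /(leq_trans lekf).
  by rewrite leqNgt fjk.
rewrite -[X in (X <= _)%N](cardlt i.+1) //.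
apply/subset_leq_card/subsetP => j; rewrite !inE => leji.
exact: leq_ltn_trans (strict_leq sf leji) fik.
Qed.

(** A multiplicity in general, the indicator of the image when [f] is strict. *)
Definition ind (m N : nat) (f : 'I_m -> 'I_N) (x : nat) : nat :=
  (\sum_i (f i == x :> nat))%N.

Lemma ind_le1 m N (f : 'I_m -> 'I_N) x : strict f -> (ind f x <= 1)%N.
Proof.
move=> sf; rewrite /ind.
case: (pickP (fun i => f i == x :> nat)) => [i /eqP fi | f0].
  rewrite (bigD1 i) //= fi eqxx big1 // => j ji.
  by rewrite -fi val_eqE (inj_eq (strict_inj sf)) (negPf ji).
by rewrite big1 // => i _; rewrite f0.
Qed.

Lemma ind_eq0 m N (f : 'I_m -> 'I_N) x :
  (ind f x == 0)%N = [forall i, f i != x :> nat].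
Proof.
rewrite /ind sum_nat_eq0; apply: eq_forallb => i /=.
by rewrite eqb0.
Qed.

Lemma sum_indM m N (f : 'I_m -> 'I_N) (F : nat -> nat) :
  (\sum_(x < N) ind f x * F x = \sum_i F (f i))%N.
Proof.
rewrite /ind; under [in LHS]eq_bigr do rewrite big_distrl /=.
rewrite exchange_big; apply: eq_bigr => i _ /=.
rewrite (bigD1 (f i)) //= eqxx mul1n big1 ?addn0 // => x.
by rewrite -val_eqE /= eq_sym => /negPf->.
Qed.

Lemma sum_ind m N (f : 'I_m -> 'I_N) k : (\sum_(x < k) ind f x)%N = cnt f k.
Proof.
elim: k => [|k IHk]; first by rewrite big_ord0 /cnt big1.
rewrite big_ord_recr /= IHk -big_split; apply: eq_bigr => i _ /=.
by rewrite ltnS; case: ltngtP.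
Qed.

Lemma prefix01_iota (F : nat -> int) N :
  prefix01 [seq F x | x <- iota 0 N]
    = [forall k : 'I_N.+1, in01 (\sum_(x < k) F x)].
Proof.
suff -> : prefix01 [seq F x | x <- iota 0 N] =
   all (fun k => in01 (\sum_(x < k) F x)) (iota 0 N.+1).
  rewrite -val_enum_ord all_map; apply/allP/forallP => [h k | h k _]; last exact: h.
  by apply: h; rewrite mem_enum.
elim: N => [|N IHN]; first by rewrite /prefix01 /= big_ord0.
rewrite -[in RHS]addn1 iotaD all_cat -IHN -addn1 iotaD map_cat cats1 /=.
rewrite andbT /prefix01 scanl_rcons all_rcons andbC; congr (_ && in01 _).
rewrite foldl_idx -cats1 big_cat big_seq1 add0n addn1 big_ord_recr /=.
by rewrite big_map -[N in iota 0 N]subn0 -/(index_iota 0 N) big_mkord.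
Qed.

Lemma row_seq_iota N (a : 'rV[int]_N) (F : nat -> int) :
  (forall x : 'I_N, a 0 x = F x) -> row_seq a 0 = [seq F x | x <- iota 0 N].
Proof.
move=> aF; rewrite -val_enum_ord -map_comp; exact: eq_map.
Qed.

(** * Interlacing of consecutive rows *)

Definition interlace (m N : nat) (f : 'I_m.+1 -> 'I_N) (g : 'I_m -> 'I_N) : bool :=
  [forall i, (f (widen_ord (leqnSn m) i) <= g i <= f (lift ord0 i))%N].

(** The left side says cnt g k <= cnt f k <= cnt g k + 1 for all k. The bounds on g_i come from k =
    g_i + 1 and k = f_(i+1) + 1; conversely, a failure at k contradicts interlacing at i = cnt f k
    or i = cnt g k. *)
Lemma cnt_interlace (m N : nat) (f : 'I_m.+1 -> 'I_N) (g : 'I_m -> 'I_N) :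
    strict f -> strict g ->
  [forall k : 'I_N.+1, in01 ((cnt f k)%:Z - (cnt g k)%:Z)] = interlace f g.
Proof.
move=> sf sg.
have in01E k : in01 ((cnt f k)%:Z - (cnt g k)%:Z)
    = (cnt g k <= cnt f k <= (cnt g k).+1)%N by rewrite /in01; lia.
apply/forallP/forallP => [h i | h k].
  have le1 : (f (widen_ord (leqnSn m) i) <= g i)%N.
    have gi : ((g i).+1 < N.+1)%N by rewrite ltnS.
    have := h (Ordinal gi); rewrite in01E /= => /andP[le_cnt _].
    rewrite -ltnS -ltn_cnt //=; apply: leq_trans le_cnt.
    by rewrite ltn_cnt.
  rewrite le1 /=.
  have fi : ((f (lift ord0 i)).+1 < N.+1)%N by rewrite ltnS.
  have := h (Ordinal fi); rewrite in01E /= => /andP[_ le_cnt].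
  rewrite -ltnS -(ltn_cnt i _ sg) -ltnS; apply: leq_trans le_cnt.
  by rewrite -[X in (X <= _)%N]/((lift ord0 i).+1) ltn_cnt.
rewrite in01E; apply/andP; split.
  rewrite leqNgt; apply/negP => lt_cnt.
  have ltm : (cnt f k < m)%N := leq_trans lt_cnt (cnt_le g k).
  have := lt_cnt; rewrite -[cnt f k]/(val (Ordinal ltm)) ltn_cnt // => gk.
  have /andP[fg _] := h (Ordinal ltm).
  have := leq_ltn_trans fg gk; rewrite -ltn_cnt //=.
  by rewrite ltnn.
rewrite leqNgt; apply/negP => lt_cnt.
have ltm : (cnt g k < m)%N by have := cnt_le f k; lia.
have /andP[_ gf] := h (Ordinal ltm).
have : (f (lift ord0 (Ordinal ltm)) < k)%N by rewrite -ltn_cnt.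
move=> /(leq_ltn_trans gf); rewrite -ltn_cnt //=.
by rewrite ltnn.
Qed.

Lemma edge_weightE (a b x : nat) : (a < b)%N ->
  edge_weight a b x
    = if (a <= x <= b)%N then if (a < x < b)%N then 2 else 1 else 0.
Proof.
move=> ltab; rewrite /edge_weight.
by case: (leqP a x); case: (leqP x b); case: (ltnP a x); case: (ltnP x b) => //=; lia.
Qed.

(** As [f] increases, an interlacing g_i avoids the values of [f] exactly when it lies strictly
    between f_i and f_(i+1), where the weight is 2. The vector [g] is arbitrary, because the
    determinant expansion runs over all [g]. *)
Lemma prod_edge_weight (m N : nat) (f : 'I_m.+1 -> 'I_N) (g : 'I_m -> 'I_N) :
    strict f ->
  \prod_i edge_weight (f (widen_ord (leqnSn m) i)) (f (lift ord0 i)) (g i)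
    = if interlace f g then 2 ^+ (\sum_i (ind f (g i) == 0))%N else 0.
Proof.
move=> sf; case: ifP => [/forallP fg | /negbT].
  rewrite -prodrXr; apply: eq_bigr => i _.
  have /andP[le1 le2] := fg i.
  have lt12 : (f (widen_ord (leqnSn m) i) < f (lift ord0 i))%N.
    by apply/(strictP _ sf) => /=.
  have -> : (ind f (g i) == 0)
      = (f (widen_ord (leqnSn m) i) < g i < f (lift ord0 i))%N.
    rewrite ind_eq0; apply/forallP/idP => [ne | /andP[lt1 lt2] k].
      by rewrite !ltn_neqAle le1 le2 !ne eq_sym ne.
    case: (leqP k i) => [leki | ltik].
      rewrite ltn_eqF //; apply: leq_ltn_trans lt1; exact: strict_leq.
    rewrite gtn_eqF //; apply: (leq_trans lt2); exact: strict_leq.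
  by rewrite edge_weightE // fg; case: ifP.
rewrite negb_forall => /existsP[i /negPf nfg]; rewrite (bigD1 i) //=.
rewrite edge_weightE ?nfg ?mul0r //.
by apply/(strictP _ sf) => /=.
Qed.

(** * The weight of the last row *)

Definition row_ok (N : nat) (a : 'rV[int]_N) : bool :=
  prefix01 (row_seq a 0) && (\sum_j a 0 j == 1).

Definition last_row_sum (N : nat) (e1 e2 : 'I_N -> int) : int :=
  \sum_(a : 'rV[asm_entry]_N |
      row_ok (int_mx a) && [forall x, e1 x + int_mx a 0 x == e2 x])
    2 ^+ num_minus_ones (int_mx a).

(** The only candidate row is the difference [a0] of the two indicators. Its partial sums are
    differences of counts, so it is admissible iff the rows interlace, and its entries -1 sit at the
    values of [g] missed by [f]. *)
Lemma last_row_sum_ind (m N : nat) (f : 'I_m.+1 -> 'I_N) (g : 'I_m -> 'I_N) :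
    strict f -> strict g ->
  last_row_sum (fun x : 'I_N => (ind g x)%:Z) (fun x => (ind f x)%:Z)
  = \prod_i edge_weight (f (widen_ord (leqnSn m) i)) (f (lift ord0 i)) (g i).
Proof.
move=> sf sg; pose F (x : nat) : int := (ind f x)%:Z - (ind g x)%:Z.
have F01 x : F x \in [:: 0; 1; -1].
  have := ind_le1 x sf; have := ind_le1 x sg; rewrite /F !inE.
  by case: (ind f x) => [|[|?]]; case: (ind g x) => [|[|?]].
pose a0 : 'rV[asm_entry]_N := \row_x SeqSub (F01 x).
have a0E (x : 'I_N) : int_mx a0 0 x = F x by rewrite !mxE.
have sumF k : \sum_(x < k) F x = (cnt f k)%:Z - (cnt g k)%:Z.
  by rewrite sumrB -!(raddf_sum Posz) !sum_ind.
rewrite prod_edge_weight // /last_row_sum.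
have a0P a :
    [forall x : 'I_N, (ind g x)%:Z + int_mx a 0 x == (ind f x)%:Z] = (a == a0).
  apply/forallP/eqP => [h | -> x]; last by rewrite a0E /F addrC subrK.
  apply/rowP => x; apply/val_inj.
  by have /eqP := h x; rewrite !mxE /= /F => <-; rewrite addrC addKr.
have a0_ok : row_ok (int_mx a0) = interlace f g.
  rewrite /row_ok (row_seq_iota a0E) prefix01_iota -(cnt_interlace sf sg).
  rewrite [X in _ && X](_ : _ = true) ?andbT.
    by apply: eq_forallb => k; rewrite sumF.
  have cntN k (h : 'I_k -> 'I_N) : cnt h N = k.
    rewrite /cnt (eq_bigr (fun=> 1%N)) ?sum1_card ?card_ord // => i _.
    by rewrite ltn_ord.
  by rewrite (eq_bigr (fun x : 'I_N => F x)) // sumF !cntN //; apply/eqP; lia.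
case: ifP => [fg | nfg]; last first.
  rewrite big_pred0 // => a; rewrite a0P andbC.
  by case: eqP => // ->; rewrite a0_ok.
rewrite (big_pred1 a0) => [|a]; last first.
  by rewrite a0P andbC /=; case: eqP => // ->; rewrite a0_ok.
congr (_ ^+ _); rewrite num_minus_onesE big_ord1.
rewrite -(sum_indM g (fun x => nat_of_bool (ind f x == 0%N))).
apply: eq_bigr => x _; rewrite a0E /F.
have := ind_le1 x sf; have := ind_le1 x sg.
by case: (ind f x) => [|[|?]]; case: (ind g x) => [|[|?]].
Qed.

(** * Zero-one vectors as position vectors *)

Lemma strict_ind_inj (m N : nat) (f g : {ffun 'I_m -> 'I_N}) :
  strict f -> strict g -> (forall x : 'I_N, ind f x = ind g x) -> f = g.
Proof.
move=> sf sg fg; apply/ffunP => i; apply/val_inj.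
have cntE k : (k <= N)%N -> cnt f k = cnt g k.
  move=> lekN; rewrite -!sum_ind !(big_ord_widen N) //.
  by apply: eq_bigr => x _; apply: fg.
have ltE (k : nat) : (k <= N)%N -> (f i < k)%N = (g i < k)%N.
  by move=> lekN; rewrite -!ltn_cnt // cntE.
apply/eqP; rewrite eqn_leq; apply/andP; split.
  by have := ltE _ (ltn_ord (g i)); rewrite !ltnS leqnn.
by have := ltE _ (ltn_ord (f i)); rewrite !ltnS leqnn.
Qed.

Lemma set_strict (m N : nat) (T : {set 'I_N}) : #|T| = m ->
  exists2 f : {ffun 'I_m -> 'I_N}, strict f & forall x : 'I_N, ind f x = (x \in T).
Proof.
move=> cardT; pose f := [ffun i : 'I_m => enum_val (cast_ord (esym cardT) i)].
have sf : strict f.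
  apply/strictP => i j ltij; rewrite !ffunE.
  pose x0 : 'I_N := enum_val (cast_ord (esym cardT) i).
  rewrite !(enum_val_nth x0) /=.
  have szT : size (enum T) = m by rewrite -cardE.
  rewrite -!(nth_map x0 0%N val) ?szT //.
  apply: (sorted_ltn_nth ltn_trans) => //; rewrite ?inE ?size_map ?szT //.
  rewrite sorted_map /enum_mem -enumT; apply: sorted_filter.
    by move=> x y z; apply: ltn_trans.
  have : sorted ltn (map val (enum 'I_N)) by rewrite val_enum_ord iota_ltn_sorted.
  by rewrite sorted_map.
exists f => // x; apply/eqP; case: (boolP (x \in T)) => xT.
  rewrite eqn_leq ind_le1 //= lt0n ind_eq0 negb_forall.
  apply/existsP; exists (cast_ord cardT (enum_rank_in xT x)).
  by rewrite negbK ffunE cast_ordK enum_rankK_in.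
rewrite ind_eq0; apply/forallP => i; rewrite ffunE.
by apply: contraNneq xT => /val_inj<-; apply: enum_valP.
Qed.

(** Existence and uniqueness of the position vector, as a boolean equation so that a sum over [g]
    collapses to one term. *)
Lemma sum_strict_ind (m N : nat) (e : 'I_N -> int) :
    (forall x, in01 (e x)) -> \sum_x e x = m%:Z ->
  exists2 f : {ffun 'I_m -> 'I_N}, strict f &
    forall g : {ffun 'I_m -> 'I_N},
      strict g && [forall x, e x == (ind g x)%:Z] = (g == f).
Proof.
move=> e01 sume; pose T := [set x | e x == 1].
have eE x : e x = (x \in T)%:Z.
  by rewrite inE; case/orP: (e01 x) => /eqP->.
have cardT : #|T| = m.
  apply/eqP; rewrite -eqz_nat -sume -sum1_card big_mkcond (raddf_sum Posz).
  by apply/eqP/eq_bigr => x _; rewrite eE; case: (_ \in _).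
have [f sf fT] := set_strict cardT; exists f => // g.
apply/andP/eqP => [[sg /forallP eg] | -> ].
  apply: strict_ind_inj => // x; apply/eqP.
  by rewrite fT -eqz_nat -(eqP (eg x)) eE.
by split=> //; apply/forallP => x; rewrite eE fT.
Qed.

(** * Induction on the number of rows *)

Definition half_asm_sum (m N : nat) (e : 'I_N -> int) : int :=
  \sum_(A : 'M[asm_entry]_(m, N) |
      half_asm (int_mx A) && [forall x, \sum_l int_mx A l x == e x])
    2 ^+ num_minus_ones (int_mx A).

Lemma half_asm_colsum m N (A : 'M[int]_(m, N)) : half_asm A ->
  (forall x, in01 (\sum_l A l x)) /\ \sum_x \sum_l A l x = m%:Z.
Proof.
case/andP=> /forallP rA /forallP cA; split=> [x|].
  have := in01_sum (isT : in01 0) (cA x).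
  by rewrite add0r big_map big_enum.
rewrite exchange_big (eq_bigr (fun=> 1)) => [|l _]; last first.
  by case/andP: (rA l) => _ /eqP.
by rewrite sumr_const card_ord natz.
Qed.

(** The last row is split off, and the upper parts are grouped by the unique strict [g] whose
    indicator gives their column sums. *)
Lemma half_asm_sumD1 (m N : nat) (f : 'I_m.+1 -> 'I_N) : strict f ->
  half_asm_sum (m + 1) (fun x : 'I_N => (ind f x)%:Z)
  = \sum_(g : {ffun 'I_m -> 'I_N} | strict g)
      half_asm_sum m (fun x : 'I_N => (ind g x)%:Z)
      * last_row_sum (fun x : 'I_N => (ind g x)%:Z) (fun x => (ind f x)%:Z).
Proof.
move=> sf; rewrite /half_asm_sum.
pose glue (p : 'M[asm_entry]_(m, N) * 'rV[asm_entry]_N) := col_mx p.1 p.2.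
have glue_bij : bijective glue.
  exists (fun A => (usubmx A, dsubmx A)) => [[A a] | A].
    by rewrite /glue /= col_mxKu col_mxKd.
  exact: vsubmxK.
rewrite (reindex glue) /=; last exact: onW_bij.
transitivity (\sum_(A : 'M[asm_entry]_(m, N) | half_asm (int_mx A))
    2 ^+ num_minus_ones (int_mx A)
    * last_row_sum (fun x => \sum_l int_mx A l x) (fun x : 'I_N => (ind f x)%:Z)).
  under [RHS]eq_bigr do rewrite big_distrr /=.
  rewrite pair_big_dep /=.
  apply: eq_big => [[A a] | [A a] _]; rewrite /glue /=; last first.
    by rewrite /int_mx map_col_mx num_minus_ones_col_mx exprD.
  rewrite /int_mx map_col_mx half_asm_col_mx -!/(int_mx _).
  have colE x : \sum_l col_mx (int_mx A) (int_mx a) l x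
     = \sum_l int_mx A l x + int_mx a 0 x.
    rewrite big_split_ord big_ord1 col_mxEd; congr (_ + _).
    by apply: eq_bigr => l _; rewrite col_mxEu.
  have -> : [forall x, \sum_l col_mx (int_mx A) (int_mx a) l x == (ind f x)%:Z]
      = [forall x, \sum_l int_mx A l x + int_mx a 0 x == (ind f x)%:Z].
    by apply: eq_forallb => x; rewrite colE.
  rewrite -andbA; congr (_ && _); rewrite /row_ok -!andbA; congr [&& _, _ & _].
  (* The new column sums are prescribed as [ind f], which is 0 or 1 for strict [f]. *)
  apply/andP/forallP => [[_ /forallP] // | h]; split; apply/forallP => // x.
  by rewrite (eqP (h x)) /in01; case: (ind f x) (ind_le1 x sf) => [|[|]].
under [RHS]eq_bigr do rewrite big_distrl /=.
rewrite [RHS](exchange_big_dep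
  (fun A : 'M[asm_entry]_(m, N) => half_asm (int_mx A))) /=; last first.
  by move=> g A _ /andP[].
apply: eq_bigr => A hA; have [c01 csum] := half_asm_colsum hA.
have [g sg gP] := sum_strict_ind c01 csum.
rewrite (big_pred1 g) => [|h]; last by rewrite hA gP.
congr (_ * _); rewrite /last_row_sum; apply: eq_bigl => a; congr (_ && _).
have := gP g; rewrite eqxx => /andP[_ /forallP eg].
by apply: eq_forallb => x; rewrite (eqP (eg x)).
Qed.

Lemma half_asm_sum_det (m N : nat) (f : {ffun 'I_m -> 'I_N}) : strict f ->
  half_asm_sum m (fun x : 'I_N => (ind f x)%:Z)
  = \det (\matrix_(i < m, j < m) cdel j (f i)).
Proof.
elim: m f => [|m IHm] f sf.
  rewrite det_mx00 /half_asm_sum (eq_bigr (fun=> 1)) => [|A _]; last first.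
    by rewrite num_minus_onesE big_ord0.
  rewrite (eq_bigl predT) => [|A].
    by rewrite sumr_const card_mx mul0n expn0.
  rewrite /half_asm -andbA; apply/and3P; split; apply/forallP=> x; first by case: x.
    by rewrite /col_seq enum_ord0.
  by rewrite big_ord0 /ind big_ord0.
have -> : half_asm_sum m.+1 (fun x : 'I_N => (ind f x)%:Z) =
          half_asm_sum (m + 1) (fun x : 'I_N => (ind f x)%:Z) by rewrite addn1.
pose w (i : 'I_m) (x : 'I_N) : int :=
  edge_weight (f (widen_ord (leqnSn m) i)) (f (lift ord0 i)) x.
rewrite half_asm_sumD1 //.
transitivity (\sum_(g : {ffun 'I_m -> 'I_N})
    (\prod_i w i (g i)) * \det (\matrix_(i < m, j < m) cdel j (g i))).
  rewrite big_mkcond; apply: eq_bigr => g _; case: ifP => [sg | /negbT].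
    by rewrite IHm // mulrC (last_row_sum_ind sf sg).
  (* For i < j with g_j <= g_i, interlacing gives g_i <= f_(i+1) <= f_j <= g_j, so rows i and j
     coincide and the determinant vanishes. *)
  rewrite negb_forall => /existsP[i]; rewrite negb_forall => /existsP[j].
  rewrite negb_imply -leqNgt => /andP[ltij ge].
  rewrite /w prod_edge_weight //.
  case: ifP => [/forallP fg | _]; last by rewrite mul0r.
  rewrite (determinant_alternate (i1 := i) (i2 := j)) ?mulr0 //.
    by rewrite -val_eqE ltn_eqF.
  move=> l; rewrite !mxE; congr cdel; apply/eqP; rewrite eqn_leq ge andbT.
  have /andP[_ le1] := fg i; have /andP[le2 _] := fg j.
  apply: leq_trans le2; apply: (leq_trans le1); exact: strict_leq.
rewrite (sum_prod_det w (fun (x : 'I_N) (j : 'I_m) => cdel j x)).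
apply: det_cdelS => i; rewrite ltn_ord andbT.
by apply/(strictP _ sf) => /=.
Qed.

(** * The boundary condition and the total *)

(** Since h_(n,2i) = n + 2i - 2 cnt f (2i), the condition is cnt f (2i) = i. Its instances at i and
    i + 1 give 2i <= f_i < 2i + 2. *)
Lemma height_boundaryE (n : nat) (A : 'M[int]_(n, 2 * n)) (f : {ffun 'I_n -> 'I_(2 * n)}) :
    strict f -> (forall x, \sum_l A l x = (ind f x)%:Z) ->
  height_boundary A = [forall i, (f i)./2 == i].
Proof.
move=> sf Af.
have heightE (i : 'I_n.+1) : (height_mx A ord_max (inord (2 * i)) == n%:Z)
    = (cnt f (2 * i) == i).
  rewrite mxE inordK ?ltnS ?leq_mul2l ?(leq_ord i) //.
  have -> : \sum_(l < n | (l < @ord_max n)%N) \sum_(r < 2 * n | (r < 2 * i)%N) A l r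
      = (cnt f (2 * i))%:Z.
    rewrite (eq_bigl predT) => [|l]; last by rewrite /= ltn_ord.
    rewrite exchange_big -sum_ind (big_ord_widen (2 * n)); last first.
      by rewrite leq_mul2l leq_ord.
    by rewrite (raddf_sum Posz); apply: eq_bigr => x _; rewrite Af.
  by rewrite /=; lia.
rewrite /height_boundary (eq_forallb heightE); apply/forallP/forallP => [h i | h i].
  have lti : (i < n.+1)%N by rewrite ltnW // ltnS.
  have /= /eqP c1 := h (Ordinal lti).
  have lti1 : (i.+1 < n.+1)%N by rewrite ltnS.
  have /= /eqP c2 := h (Ordinal lti1).
  have f1 := ltn_cnt i (2 * i) sf; have f2 := ltn_cnt i (2 * i.+1) sf.
  move: f1 f2; rewrite c1 c2 ltnn ltnSn; lia.
rewrite /cnt; apply/eqP; transitivity (\sum_(j < n) (j < i))%N.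
  by apply: eq_bigr => j _; have /eqP := h j; lia.
rewrite -[RHS]muln1 -[in RHS](card_ord i) -sum_nat_const.
rewrite (big_ord_widen n (fun=> 1%N)) ?leq_ord // [RHS]big_mkcond.
by apply: eq_bigr => j _; case: ltnP.
Qed.

End TwoEnumeration.


Theorem theorem1 (n : nat) (hn : (1 <= n)%N) :
  (\sum_(A in bounded_halved_asms n) 2 ^ num_minus_ones (int_mx A))%N
    = (2 ^ (n ^ 2))%N.
Proof.
have strict_half (f : {ffun 'I_n -> 'I_(2 * n)}) :
    [forall i, (f i)./2 == i] -> strict f.
  move=> /forallP fh; apply/strictP => i j ltij.
  by have /eqP := fh i; have /eqP := fh j; lia.
apply/eqP; rewrite -eqz_nat (raddf_sum Posz); apply/eqP.
transitivity (\sum_(f : {ffun 'I_n -> 'I_(2 * n)} | [forall i, (f i)./2 == i])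
   half_asm_sum n (fun x : 'I_(2 * n) => Posz (ind f x)))%R.
  rewrite /half_asm_sum (exchange_big_dep [in bounded_halved_asms n]) /=.
    apply: eq_bigr => A; rewrite inE half_asmE => /andP[hA bA].
    have [c01 csum] := half_asm_colsum hA.
    have [g sg gP] := sum_strict_ind c01 csum.
    have /forallP eg : [forall x, \sum_l int_mx A l x == Posz (ind g x)]%R.
      by have := gP g; rewrite eqxx => /andP[].
    have cg x := eqP (eg x).
    rewrite (big_pred1 g) => [|h]; first by rewrite -natrX natz.
    rewrite hA /= -gP; apply/andP/andP => [[/strict_half] // | [sh eh]]; split=> //.
    by rewrite -(height_boundaryE (A := int_mx A) sh) // => x; apply/eqP/(forallP eh).
  move=> f A hf /andP[hA /forallP eA]; rewrite inE half_asmE hA.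
  by rewrite (height_boundaryE (A := int_mx A) (strict_half _ hf)) // => x; apply/eqP.
(* The boundary condition becomes a product of factors 0 or 1, one per row, so that [sum_prod_det]
   applies to the sum over all [f]. *)
transitivity (\sum_(f : {ffun 'I_n -> 'I_(2 * n)})
    (\prod_i ((f i)./2 == i)%:R) * \det (\matrix_(i < n, j < n) cdel j (f i)))%R.
  rewrite big_mkcond; apply: eq_bigr => f _; case: ifP => [hf | /negbT].
    rewrite half_asm_sum_det ?strict_half // big1 ?mul1r // => i _.
    by rewrite (forallP hf).
  rewrite negb_forall => /existsP[i /negPf hi].
  by rewrite (bigD1 i) //= hi !mul0r.
rewrite (sum_prod_det (fun (i : 'I_n) (x : 'I_(2 * n)) => ((x./2 == i)%:R : int)%R)
  (fun (x : 'I_(2 * n)) (j : 'I_n) => cdel j x)).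
rewrite -[RHS]natz natrX -det_cdel2; congr (\det _)%R; apply/matrixP => i j.
(* Only x = 2i and x = 2i + 1 have half i, and they produce the two terms of [cdel2 i j]. *)
have lt1 : (i.*2 < 2 * n)%N by have := ltn_ord i; lia.
have lt2 : (i.*2.+1 < 2 * n)%N by have := ltn_ord i; lia.
rewrite !mxE (bigD1 (Ordinal lt1)) //= (bigD1 (Ordinal lt2)) /=; last first.
  by rewrite -val_eqE /= gtn_eqF.
rewrite doubleK uphalf_double eqxx !mul1r big1 ?addr0 // => x /andP[].
rewrite -!val_eqE /= => x1 x2.
by rewrite (_ : _ == _ = false) ?mul0r //; lia.
Qed.
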